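(* Let $(X,* )$ be a rack and let $\Bbbk$ be a field. Any averaging operator $B:X\to X$ on the rack $X$ is extended by linearity to an averaging operator on the rack algebra $\Bbbk[X]$; that is, the linear map $B:\Bbbk[X]\to\Bbbk[X]$ given by $$B\Big(\sum_{x\in X}\alpha_x x\Big):=\sum_{x\in X}\alpha_x B(x),\qquad \alpha_x\in\Bbbk,$$ is an averaging operator on the algebra $\Bbbk[X]$.
   Context: A rack is a non-empty set $X$ with a binary operation $*$ such that for all $x,y\in X$ there is a unique $z\in X$ with $x=z*y$, and $(x*y)*z=(x*z)*(y*z)$ for all $x,y,z\in X$. An averaging operator on a rack $(X,* )$ means a right averaging operator, i.e. a map $B:X\to X$ with $B(x)*B(y)=B(x*B(y))$ for all $x,y\in X$. The rack algebra $\Bbbk[X]$ is the (in general non-associative) $\Bbbk$-algebra with basis $X$ whose multiplication is the bilinear extension of $*$. An averaging operator on a $\Bbbk$-algebra $A$ likewise means a right averaging operator, i.e. a linear map $R:A\to A$ with $R(u)R(v)=R(uR(v))$ for all $u,v\in A$. *)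

(* Defs.v *)
From HB Require Import structures.
From mathcomp Require Export all_boot all_order all_algebra.
From mathcomp Require Export finmap monalg.

Set Implicit Arguments.
Unset Strict Implicit.
Unset Printing Implicit Defensive.

Import GRing.Theory.
Local Open Scope ring_scope.

(* In this file (x * y)%g is the product of a bare magma: no associativity or
   unit is assumed.  It is used both for racks and for algebras. *)

HB.mixin Record Magma_isRack X of ChoiceMagma X := {
  rack_inhabited : inhabited X;
  rack_divr : forall x y : X, exists! z : X, x = (z * y)%g;
  rack_distr : forall x y z : X, (x * y * z = (x * z) * (y * z))%g
}.

#[short(type="rackType")]
HB.structure Definition Rack := {X of ChoiceMagma X & Magma_isRack X}.

(* Algebras over K in the non-associative sense, possibly without unit
   (lalgType and algType are associative and unital). *)
HB.mixin Record Lmodule_isNonAssocAlgebra (K : nzRingType) A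
    of GRing.Lmodule K A & Magma A := {
  mulg_bilinear :
    bilinear_for (@GRing.scale K A) (@GRing.scale K A) (fun u v : A => (u * v)%g)
}.

#[short(type="nonAssocAlgType")]
HB.structure Definition NonAssocAlgebra (K : nzRingType) :=
  {A of GRing.Lmodule K A & Magma A & Lmodule_isNonAssocAlgebra K A}.

(* Right averaging identity. *)
Definition averaging (X : magmaType) (B : X -> X) : Prop :=
  forall x y : X, (B x * B y = B (x * B y))%g.

Definition averaging_operator (K : nzRingType) (A : nonAssocAlgType K)
  (R : A -> A) : Prop := linear R /\ averaging R.

(* The finitely supported functions X -> K.  The alias keeps the product below
   apart from the monoid-algebra product of {malg K[X]}. *)
Definition rack_algebra (K : fieldType) (X : rackType) : Type := {malg K[X]}.

HB.instance Definition _ (K : fieldType) (X : rackType) :=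
  GRing.Lmodule.copy (rack_algebra K X) {malg K[X]}.

Section RackAlgebra.
Variables (K : fieldType) (X : rackType).
Implicit Types u v w : rack_algebra K X.

Definition rack_algebra_mul u v : rack_algebra K X :=
  \sum_(x <- msupp u) \sum_(y <- msupp v) (u@_x * v@_y) *: << (x * y)%g >>.

HB.instance Definition _ := hasMul.Build (rack_algebra K X) rack_algebra_mul.

Lemma rack_algebra_mulE u v (D E : {fset X}) :
    (msupp u `<=` D)%fset -> (msupp v `<=` E)%fset ->
  (u * v)%g =
    \sum_(x <- D) \sum_(y <- E) (u@_x * v@_y) *: << (x * y)%g >>
    :> rack_algebra K X.
Proof.
move=> uD vE; change (u * v)%g with (rack_algebra_mul u v).
rewrite /rack_algebra_mul (big_fset_incl _ uD) /=; last first.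
  by move=> x _ /mcoeff_outdom ->; apply: big1 => y _; rewrite mul0r scale0r.
apply: eq_bigr => x _; apply: big_fset_incl => // y _ /mcoeff_outdom ->.
by rewrite mulr0 scale0r.
Qed.

Lemma rack_algebra_mul_bilinear :
  bilinear_for (@GRing.scale K (rack_algebra K X))
    (@GRing.scale K (rack_algebra K X))
    (fun u v : rack_algebra K X => (u * v)%g).
Proof.
split=> [w a u v | w a u v] /=.
- pose D := (msupp (a *: u + v) `|` msupp u `|` msupp v)%fset.
  have sD z : z \in [:: a *: u + v; u; v] -> (msupp z `<=` D)%fset.
    rewrite !inE => /or3P[] /eqP->; apply/fsubsetP => x xz;
      by rewrite !in_fsetU xz ?orbT.
  rewrite !(@rack_algebra_mulE _ _ D (msupp w)) ?fsubset_refl ?sD ?inE ?eqxx ?orbT //.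
  rewrite scaler_sumr -big_split; apply: eq_bigr => x _ /=.
  rewrite scaler_sumr -big_split; apply: eq_bigr => y _ /=.
  by rewrite mcoeffD mcoeffZ mulrDl scalerDl -mulrA scalerA.
- pose D := (msupp (a *: u + v) `|` msupp u `|` msupp v)%fset.
  have sD z : z \in [:: a *: u + v; u; v] -> (msupp z `<=` D)%fset.
    rewrite !inE => /or3P[] /eqP->; apply/fsubsetP => x xz;
      by rewrite !in_fsetU xz ?orbT.
  rewrite !(@rack_algebra_mulE _ _ (msupp w) D) ?fsubset_refl ?sD ?inE ?eqxx ?orbT //.
  rewrite scaler_sumr -big_split; apply: eq_bigr => x _ /=.
  rewrite scaler_sumr -big_split; apply: eq_bigr => y _ /=.
  by rewrite mcoeffD mcoeffZ mulrDr scalerDl mulrCA scalerA.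
Qed.

HB.instance Definition _ :=
  Lmodule_isNonAssocAlgebra.Build K (rack_algebra K X) rack_algebra_mul_bilinear.

Lemma rack_algebra_mulU (x y : X) :
  ((<< x >> : rack_algebra K X) * (<< y >> : rack_algebra K X))%g
    = << (x * y)%g >> :> rack_algebra K X.
Proof.
rewrite (rack_algebra_mulE msuppU_le msuppU_le) !big_seq_fset1 !mcoeffUU.
by rewrite mulr1 scale1r.
Qed.

Definition linear_extension (B : X -> X) u : rack_algebra K X :=
  \sum_(x <- msupp u) u@_x *: << B x >>.

Lemma linear_extensionU (B : X -> X) (x : X) :
  linear_extension B << x >> = << B x >>.
Proof.
rewrite /linear_extension (big_fset_incl _ msuppU_le) /=; last first.
  by move=> y _ /mcoeff_outdom ->; rewrite scale0r.
by rewrite big_seq_fset1 mcoeffUU scale1r.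
Qed.

End RackAlgebra.

Arguments linear_extension K {X} B u.

(* Main.v *)
Require Import Defs.
From HB Require Import structures.

Set Implicit Arguments.
Unset Strict Implicit.
Unset Printing Implicit Defensive.

Import GRing.Theory.
Local Open Scope ring_scope.

(** In [R u * R v = R (u * R v)], where [R] is the linear extension of [B],
both sides are linear in [u] for fixed [v] and linear in [v] for fixed [u]:
[R] is linear, the product of the rack algebra is bilinear, and linear maps
compose. A linear map on the rack algebra is determined by its values on the
basis ([rack_algebra_linear_eq]), so it is enough to compare the two sides at
basis elements [u = << x >>] and [v = << y >>]. There [R] acts as [B] and the
product is that of the rack, so the identity is the averaging identity
[B x * B y = B (x * B y)]. *)

Lemma linear_comp (K : nzRingType) (U V W : lmodType K) (f : V -> W)
  (g : U -> V) : linear f -> linear g -> linear (f \o g).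
Proof. by move=> f_lin g_lin a u v /=; rewrite g_lin f_lin. Qed.

Section RackAlgebraLinear.
Variables (K : fieldType) (X : rackType).

(** This reduces identities between linear maps to the basis: every element is
the finite sum of its coefficients times the elements of its support. *)
Lemma rack_algebra_linear_eq (V : lmodType K) (f g : rack_algebra K X -> V) :
  linear f -> linear g -> (forall x, f << x >> = g << x >>) -> f =1 g.
Proof.
move=> f_lin g_lin eq_fg u.
pose fL := GRing.isLinear.Build K (rack_algebra K X) V *:%R f f_lin.
pose gL := GRing.isLinear.Build K (rack_algebra K X) V *:%R g g_lin.
pose F : {linear rack_algebra K X -> V} := HB.pack f fL.
pose G : {linear rack_algebra K X -> V} := HB.pack g gL.
rewrite -[f]/(F : _ -> _) -[g]/(G : _ -> _).
have -> : u = \sum_(x <- msupp u) u@_x *: (<< x >> : rack_algebra K X).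
  rewrite {1}(monalgE u); apply: eq_bigr => x _.
  by apply/malgP => y; rewrite mcoeffZ !mcoeffU mulr_natr.
rewrite !linear_sum; apply: eq_bigr => x _.
by rewrite !linearZ; congr (_ *: _); apply: eq_fg.
Qed.

(** The supports of [u], [v] and [a *: u + v] differ in general; linearity
becomes visible once the three sums range over one common finite set. *)
Lemma linear_extension_linear (B : X -> X) : linear (linear_extension K B).
Proof.
move=> a u v.
have extE (D : {fset X}) (w : rack_algebra K X) : (msupp w `<=` D)%fset ->
    linear_extension K B w =
      \sum_(x <- D) w@_x *: (<< B x >> : rack_algebra K X).
  move=> wD; apply: big_fset_incl => // x _ /mcoeff_outdom ->.
  by rewrite scale0r.
pose D := (msupp (a *: u + v) `|` msupp u `|` msupp v)%fset.
have sD z : z \in [:: a *: u + v; u; v] -> (msupp z `<=` D)%fset.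
  rewrite !inE => /or3P[] /eqP->; apply/fsubsetP => x xz;
    by rewrite !in_fsetU xz ?orbT.
rewrite !(extE D) ?sD ?inE ?eqxx ?orbT //.
rewrite scaler_sumr -big_split; apply: eq_bigr => x _ /=.
by rewrite mcoeffD mcoeffZ scalerDl scalerA.
Qed.

End RackAlgebraLinear.

Theorem proposition6p7 (K : fieldType) (X : rackType) (B : X -> X) :
  averaging B -> averaging_operator (linear_extension K B).
Proof.
move=> avgB; have R_lin := @linear_extension_linear K X B; split=> // u v.
set R := linear_extension K B in R_lin *.
have [mul_linl mul_linr] := @mulg_bilinear K (rack_algebra K X).
(* Naming the two partial products lets both sides be read as composites of
   linear maps, first in [u] and then in [v]. *)
pose mull w u : rack_algebra K X := (u * w)%g.
pose mulr u w : rack_algebra K X := (u * w)%g.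
apply: (@rack_algebra_linear_eq _ _ _ (mull (R v) \o R) (R \o mull (R v))).
- exact: linear_comp (mul_linl _) R_lin.
- exact: linear_comp R_lin (mul_linl _).
move=> x; apply: (@rack_algebra_linear_eq _ _ _
  (mulr (R << x >>) \o R) (R \o (mulr << x >> \o R))).
- exact: linear_comp (mul_linr _) R_lin.
- exact: linear_comp R_lin (linear_comp (mul_linr _) R_lin).
move=> y /=; rewrite /mulr /R !linear_extensionU !rack_algebra_mulU.
by rewrite linear_extensionU avgB.
Qed.
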